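(* Let $n\ge 2$, $\mathfrak g=\mathfrak{sl}(n,\mathbb C)$ with the standard Cartan subalgebra, Borel subalgebra and notation described in the context, let $\lambda\in\mathfrak h^*$ and put $\lambda_i=(\lambda+\rho)(H_i)$ for $i=1,\dots,n-1$. Let $1\le k<l\le n$, $\alpha=e_k-e_l$, and let $s_\alpha$ act on $\mathcal A_1$ by the representation of $S_n$ described in the context (the constant function $1\in\mathcal A_1$ being weighted of weight $\lambda$). Put \[ \Gamma_{k,l}:=\{a\in\Gamma\ :\ a_{i,j}=0 \text{ whenever } i=j+1, \text{ or } i>l, \text{ or } j<k\}. \] For $a\in\Gamma_{k,l}$ and $i=k,\dots,l-1$ define \[ r_i=\sum_{(q,j):\ j<i+1<q} a_{q,j},\qquad t_i=r_i+\sum_{j<i}a_{i+1,j},\qquad u_i=\sum_{j=k}^{i}\lambda_j \] (so $r_{l-1}=0$). Then \[ s_\alpha(1)=\sum_{a\in\Gamma_{k,l}}\frac{\prod_{i=k}^{l-1}\langle u_i\rangle_{r_i}\,\langle u_{l-1}-r_i\rangle_{t_i-r_i}\,x_{i+1,i}^{\,u_{l-1}-t_i}}{\prod_{i>j}a_{i,j}!}\,x^a . \] In particular, $s_\alpha(1)$ is a polynomial (i.e. lies in $\mathcal A=\mathbb C[x_{i,j}:1\le j<i\le n]$) if and only if $u_{l-1}=\langle\lambda+\rho,e_k-e_l\rangle\in\mathbb N$.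
   Context: $\mathfrak g=\mathfrak{sl}(n,\mathbb C)$; $E_{i,j}$ is the matrix unit; $H_i=E_{i,i}-E_{i+1,i+1}$ ($1\le i\le n-1$) is a basis of the Cartan subalgebra $\mathfrak h$; positive root vectors are $E_{i,j}$ ($i<j$) with roots $e_i-e_j$, where $e_i(E_{j,j})=\delta_{ij}$; $\rho$ is half the sum of positive roots, so $\rho(H_i)=1$. $\mathbb N=\{0,1,2,\dots\}$. $\Gamma=\sum_{1\le j<i\le n}\mathbb N\epsilon_{i,j}$, and for $a=\sum a_{i,j}\epsilon_{i,j}\in\Gamma$, $x^a=\prod_{1\le j<i\le n}x_{i,j}^{a_{i,j}}$. For $\gamma\in\mathbb C$, $k\in\mathbb N$: $\langle\gamma\rangle_k=\gamma(\gamma-1)\cdots(\gamma-k+1)$, $\langle\gamma\rangle_0=1$. Write $\partial_{i,j}=\partial/\partial x_{i,j}$. Space $\mathcal A_1$: let $\mathcal A_0=\mathbb C[x_{i,j}:1\le j<i-1\le n-1]$ and, for $z\in\mathbb C^{n-1}$, $\mathbf x^z=\prod_{i=1}^{n-1}x_{i+1,i}^{z_i}$. $\mathcal A_1$ is the space of finite sums $\sum_{i=1}^p\sum_{b\in\mathbb N^{n-1}}f_{z^i-b}\mathbf x^{z^i-b}$ with $z^i\in\mathbb C^{n-1}$, $f_{z^i-b}\in\mathcal A_0$ (truncated-up formal power series in $x_{2,1},\dots,x_{n,n-1}$ with complex exponents over $\mathcal A_0$); derivatives act formally ($\partial_{i+1,i}x_{i+1,i}^c=c\,x_{i+1,i}^{c-1}$).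 Operators on $\mathcal A_1$: for $i=1,\dots,n-1$, $\zeta_i=\lambda_i-1-\sum_{j=1}^{i-1}(x_{i,j}\partial_{i,j}-x_{i+1,j}\partial_{i+1,j})+\sum_{j=i+2}^n(x_{j,i+1}\partial_{j,i+1}-x_{j,i}\partial_{j,i})-2x_{i+1,i}\partial_{i+1,i}$, and $\eta_i=x_{i+1,i}+\sum_{j=1}^{i-1}x_{i+1,j}\partial_{i,j}$; for $c\in\mathbb C$, $\eta_i^c=\sum_{p=0}^\infty\frac{\langle c\rangle_p}{p!}x_{i+1,i}^{c-p}\big(\sum_{j=1}^{i-1}x_{i+1,j}\partial_{i,j}\big)^p$. An element $f\in\mathcal A_1$ is weighted of weight $\mu\in\mathfrak h^*$ if $\zeta_i(f)=\mu(H_i)f$ for all $i$; the constant $1$ has weight $\lambda$. For weighted $f$ of weight $\mu$ set $s_i(f)=\eta_i^{(\mu+\rho)(H_i)}f$, extended additively to sums of weighted elements. By a result of Xu, this defines a representation of the symmetric group $S_n$ on $\mathcal A_1$, with $s_i$ the simple transposition $(i\ i+1)$. For $\alpha=e_k-e_l$, $s_\alpha$ denotes the action of the transposition $(k\ l)$, e.g. $s_\alpha=s_{l-1}s_{e_k-e_{l-1}}s_{l-1}$ and $s_{e_k-e_{k+1}}=s_k$.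
   Formalization: In the operator ζ_i, the sum over j<i of (x_{i,j}∂_{i,j} − x_{i+1,j}∂_{i+1,j}) is taken with a plus sign instead of the printed minus sign; with the minus sign the formula fails already for n=3, k=1, l=3. *)

(* Defs.v *)
From mathcomp Require Import all_boot all_algebra.
From mathcomp Require Import reals complex.
Set Implicit Arguments. Unset Strict Implicit. Unset Printing Implicit Defensive.
Import GRing.Theory Num.Theory.
Local Open Scope ring_scope.

Section Defs.
Variable C : fieldType.
Variable n : nat.

(* Indices are 1-based: a variable x_{i,j} (1 <= j < i <= n) is indexed by the
   pair (i, j) : 'I_n.+1 * 'I_n.+1; index 0 is unused. *)
Definition pos := ('I_n.+1 * 'I_n.+1)%type.
Definition lower (p : pos) : bool := (0 < p.2 < p.1)%N.
Definition X (i j : nat) : pos := (inord i, inord j).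

Definition expo := {ffun pos -> C}.
Definition shift (e : expo) (q : pos) (s : C) : expo :=
  [ffun p => e p + (if p == q then s else 0)].

(* A formal series: coefficient of x^e for each exponent vector e.  Elements
   of A_1 are represented by their coefficient functions. *)
Definition series := expo -> C.

Definition one_ser : series := fun e => if e == [ffun => 0] then 1 else 0.

Definition xmul (q : pos) (s : C) (f : series) : series :=
  fun e => f (shift e q (- s)).
Definition dpart (q : pos) (f : series) : series :=
  fun e => (e q + 1) * f (shift e q 1).
Definition euler (q : pos) (f : series) : series := xmul q 1 (dpart q f).

Definition ff (g : C) (k : nat) : C := \prod_(m < k) (g - m%:R).

(* lam i = lambda(H_i)  (so lambda_i = (lambda+rho)(H_i) = lam i + 1). *)
Definition zeta (lam : nat -> C) (i : nat) (f : series) : series :=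
  fun e =>
    lam i * f e
    + \sum_(j < n.+1 | (0 < j < i)%N) (euler (X i j) f e - euler (X i.+1 j) f e)
    + \sum_(j < n.+1 | (i.+2 <= j)%N) (euler (X j i.+1) f e - euler (X j i) f e)
    - 2%:R * euler (X i.+1 i) f e.

Definition weighted (lam : nat -> C) (mu : nat -> C) (f : series) : Prop :=
  forall i, (0 < i < n)%N -> forall e, zeta lam i f e = mu i * f e.

Definition Dop (i : nat) (f : series) : series :=
  fun e => \sum_(j < n.+1 | (0 < j < i)%N) xmul (X i.+1 j) 1 (dpart (X i j) f) e.

Definition eta_term (c : C) (i : nat) (f : series) (p : nat) : series :=
  fun e => ff c p / (p`!)%:R * xmul (X i.+1 i) (c - p%:R) (iter p (Dop i) f) e.

(* g = eta_i^c f, the infinite sum being a formal (coefficientwise) sum *)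
Definition eta_rel (c : C) (i : nat) (f g : series) : Prop :=
  forall e, exists N, forall M, (N <= M)%N ->
    g e = \sum_(p < M) eta_term c i f p e.

Definition s_rel (lam : nat -> C) (i : nat) (f g : series) : Prop :=
  exists mu : nat -> C, weighted lam mu f /\ eta_rel (mu i + 1) i f g.

(* g = s_alpha(f), alpha = e_k - e_{k+d+1}, via
   s_{e_k - e_l} = s_{l-1} s_{e_k - e_{l-1}} s_{l-1},  s_{e_k-e_{k+1}} = s_k *)
Fixpoint salpha_rel (lam : nat -> C) (k d : nat) (f g : series) : Prop :=
  match d with
  | 0 => s_rel lam k f g
  | d'.+1 => exists f1 f2, s_rel lam (k + d) f f1 /\
               salpha_rel lam k d' f1 f2 /\ s_rel lam (k + d) f2 g
  end.

Definition lamr (lam : nat -> C) (j : nat) : C := lam j + 1.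
Definition u (lam : nat -> C) (k i : nat) : C := \sum_(k <= j < i.+1) lamr lam j.

Definition gam := {ffun pos -> nat}.
Definition inGamma (k l : nat) (a : gam) : Prop :=
  forall p : pos, a p <> 0%N ->
    [/\ lower p, p.1 != (p.2).+1 :> nat, (p.1 <= l)%N & (k <= p.2)%N].

Definition rr (a : gam) (i : nat) : nat :=
  \sum_(q < n.+1) \sum_(j < n.+1 | (j < i.+1 < q)%N) a (q, j).
Definition tt (a : gam) (i : nat) : nat :=
  rr a i + \sum_(j < n.+1 | (0 < j < i)%N) a (inord i.+1, j).

Definition coeff (lam : nat -> C) (k l : nat) (a : gam) : C :=
  (\prod_(k <= i < l) (ff (u lam k i) (rr a i)
        * ff (u lam k l.-1 - (rr a i)%:R) (tt a i - rr a i)))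
  / \prod_(p : pos | lower p) ((a p)`!)%:R.

Definition mono (lam : nat -> C) (k l : nat) (a : gam) : expo :=
  [ffun p : pos => if ((p.1 : nat) == (p.2).+1) && (k <= p.2 < l)%N
                   then u lam k l.-1 - (tt a p.2)%:R
                   else (a p)%:R].

Definition is_poly (f : series) : Prop :=
  exists s : seq expo, forall e, f e != 0 ->
    e \in s /\ forall p : pos, (exists m : nat, e p = m%:R) /\ (~~ lower p -> e p = 0).

End Defs.

(* Main.v *)
Require Import Defs.
From mathcomp Require Import all_boot all_algebra.
From mathcomp Require Import reals complex.
From mathcomp Require Import boolp zify ring.
Import GRing.Theory Num.Theory.
Local Open Scope ring_scope.
Local Open Scope complex_scope.

(** Induction on [l - k], started from an arbitrary monomial [x^e0] in the
    variables [x_{i+1,i}] with [i >= l] in place of the constant [1].  Applying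
    [s_{l-1}] to [x^e0] multiplies it by [x_{l,l-1}^{lambda_{l-1}}], which turns
    [lambda_{l-2}] into [lambda_{l-2} + lambda_{l-1}], hence [u_{l-2}] into
    [u_{l-1}]; the induction hypothesis then gives
    [f = s_{e_k - e_{l-1}} s_{l-1} (x^e0)].  The iterates of
    [D = \sum_j x_{l,j} d_{l-1,j}] on [f] have a closed form [hser p], a sum over
    the exponents [a] with [r_{l-2}(a) = p]; the identity [D (hser p) = hser p.+1]
    reduces to [\sum_j a_{l,j} = p.+1], because applying [x_{l,j} d_{l-1,j}]
    to the term preceding [a] yields [a_{l,j} p!] times the coefficient of [a].
    In [eta_{l-1}^c f] each exponent then receives exactly one term.
    Weights are tracked separately: [eta_i^c] shifts them by [- c alpha_i]. *)

Set Implicit Arguments.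
Unset Strict Implicit.
Unset Printing Implicit Defensive.

(** * Shifts of exponent vectors, falling factorials, monomials *)

Section Exponents.
Variables (C : fieldType) (n : nat).
Implicit Types (e : expo C n) (p q : pos n).

Lemma shiftE e q s p : shift e q s p = e p + (if p == q then s else 0).
Proof. by rewrite ffunE. Qed.

Lemma shiftD e q s t : shift (shift e q s) q t = shift e q (s + t).
Proof. by apply/ffunP=> p; rewrite !ffunE; case: eqP => _; rewrite ?addr0 ?addrA. Qed.

Lemma shift0 e q : shift e q 0 = e.
Proof. by apply/ffunP=> p; rewrite !ffunE if_same addr0. Qed.

Lemma X_eq i j i' j' : (i <= n)%N -> (j <= n)%N -> (i' <= n)%N -> (j' <= n)%N ->
  (X n i j == X n i' j') = (i == i') && (j == j').
Proof. by move=> *; rewrite xpair_eqE -!val_eqE /= !inordK. Qed.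

Lemma eq_X p i j : (i <= n)%N -> (j <= n)%N ->
  (p == X n i j) = (p.1 == i :> nat) && (p.2 == j :> nat).
Proof. by case: p => x y ? ?; rewrite xpair_eqE -!val_eqE /= !inordK. Qed.

Lemma ff0 (g : C) : ff g 0 = 1.
Proof. exact: big_ord0. Qed.

Lemma ffS (g : C) k : ff g k.+1 = ff g k * (g - k%:R).
Proof. exact: big_ord_recr. Qed.

Lemma ffD (g : C) k m : ff g (k + m) = ff g k * ff (g - k%:R) m.
Proof.
elim: m => [|m IH]; first by rewrite addn0 ff0 mulr1.
by rewrite addnS !ffS IH mulrA natrD opprD addrA.
Qed.

Lemma ff_nat_eq0 m k : (m < k)%N -> ff (m%:R : C) k = 0.
Proof. by move=> mk; rewrite /ff (bigD1 (Ordinal mk)) //= subrr mul0r. Qed.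

Lemma eulerE q (f : series C n) e : euler q f e = e q * f e.
Proof. by rewrite /euler /xmul /dpart shiftD addNr shift0 ffunE eqxx subrK. Qed.

Definition mon e0 : series C n := fun e => if e == e0 then 1 else 0.

End Exponents.

(** * Weights of monomials and their change under [eta_i^c] *)

Section Weights.
Variables (C : fieldType) (n : nat).
Implicit Types (e : expo C n) (f g : series C n) (lam mu : nat -> C).

(** The operator [zeta] is diagonal on monomials, and this is its eigenvalue on x^e. Being weighted
    is therefore a condition on the support alone. *)
Definition wt lam (i : nat) e : C :=
  lam i + \sum_(j < n.+1 | (0 < j < i)%N) (e (X n i j) - e (X n i.+1 j))
  + \sum_(j < n.+1 | (i.+2 <= j)%N) (e (X n j i.+1) - e (X n j i))
  - 2%:R * e (X n i.+1 i).

Lemma zetaE lam i f e : zeta lam i f e = wt lam i e * f e.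
Proof.
rewrite /zeta /wt !eulerE mulrBl !mulrDl -mulrA !mulr_suml.
by congr (_ + _ + _ - _); apply: eq_bigr => j _; rewrite !eulerE mulrBl.
Qed.

Lemma weightedP lam mu f :
  weighted lam mu f <->
  forall i, (0 < i < n)%N -> forall e, f e != 0 -> wt lam i e = mu i.
Proof.
split=> H i ii e; last first.
  rewrite zetaE; have [->|/H ->//] := eqVneq (f e) 0; by rewrite !mulr0.
by move=> fe; have := H i ii e; rewrite zetaE => /(mulIf fe).
Qed.

(** This is e_q(H_i). *)
Definition eps_at (i q : nat) : C := (q == i)%:R - (q == i.+1)%:R.
(* [root_at i q r] is [(e_q - e_r)(H_i)], the weight of [x_{q,r}]. *)
Definition root_at (i q r : nat) : C := eps_at i q - eps_at i r.

Lemma sum_pred1_ord (P : pred nat) (b : bool) r (s : C) : (r <= n)%N ->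
  \sum_(j < n.+1 | P j) (if b && (j == r :> nat) then s else 0) =
  if b && P r then s else 0.
Proof.
move=> rn; case: b => /=; last by rewrite big1.
rewrite -big_mkcondr /=; case: ifP => Pr.
  rewrite (big_pred1 (inord r)) // => j /=.
  rewrite -val_eqE /= inordK //; case: eqP => [->|]; by rewrite ?Pr ?andbF.
by rewrite big1 // => j /andP[Pj /eqP jr]; rewrite -jr Pj in Pr.
Qed.

Lemma wt_shift lam i e q r s : (0 < i < n)%N -> (0 < r < q)%N -> (q <= n)%N ->
  wt lam i (shift e (X n q r) s) = wt lam i e + s * root_at i q r.
Proof.
move=> iin rq qn.
have S1 : \sum_(j < n.+1 | (0 < j < i)%N)
     (shift e (X n q r) s (X n i j) - shift e (X n q r) s (X n i.+1 j))
  = \sum_(j < n.+1 | (0 < j < i)%N) (e (X n i j) - e (X n i.+1 j))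
    + ((if (i == q) && (0 < r < i)%N then s else 0)
       - (if (i.+1 == q) && (0 < r < i)%N then s else 0)).
  have rn : (r <= n)%N by lia.
  rewrite -!(sum_pred1_ord (fun j => 0 < j < i)%N) // -sumrB -big_split /=.
  apply: eq_bigr => j ji; have := ltn_ord j => jn.
  rewrite !shiftE !X_eq; try lia; ring.
have S2 : \sum_(j < n.+1 | (i.+2 <= j)%N)
     (shift e (X n q r) s (X n j i.+1) - shift e (X n q r) s (X n j i))
  = \sum_(j < n.+1 | (i.+2 <= j)%N) (e (X n j i.+1) - e (X n j i))
    + ((if (i.+1 == r) && (i.+2 <= q)%N then s else 0)
       - (if (i == r) && (i.+2 <= q)%N then s else 0)).
  rewrite -!(sum_pred1_ord (fun j => i.+2 <= j)%N) // -sumrB -big_split /=.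
  apply: eq_bigr => j ji; have := ltn_ord j => jn.
  rewrite !shiftE !X_eq; try lia.
  rewrite ![(_ == q) && _]andbC; ring.
rewrite /wt S1 S2 shiftE X_eq; try lia.
have -> : s * root_at i q r =
  ((if (i == q) && (0 < r < i)%N then s else 0)
       - (if (i.+1 == q) && (0 < r < i)%N then s else 0)) +
  ((if (i.+1 == r) && (i.+2 <= q)%N then s else 0)
       - (if (i == r) && (i.+2 <= q)%N then s else 0))
  - 2%:R * (if (i.+1 == q) && (i == r) then s else 0).
  (* For q = i+1 and r = i neither sum contributes, and the last term alone supplies the value -2 of
     the root on H_i. *)
  have [-> -> -> ->] : [/\ (i == q) && (0 < r < i)%N = (i == q),
      (i.+1 == q) && (0 < r < i)%N = (i.+1 == q) && (i != r),
      (i.+1 == r) && (i.+2 <= q)%N = (i.+1 == r) &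
      (i == r) && (i.+2 <= q)%N = (i == r) && (i.+1 != q)] by split; lia.
  rewrite /root_at /eps_at ![_ == i]eq_sym ![_ == i.+1]eq_sym.
  by case: (i == q); case: (i.+1 == q); case: (i == r); case: (i.+1 == r) => /=; ring.
ring.
Qed.

Lemma root_at_cat i q r s : root_at i q r + root_at i r s = root_at i q s.
Proof. by rewrite /root_at; ring. Qed.

Lemma DopE i f e : (i < n)%N ->
  Dop i f e = \sum_(j < n.+1 | (0 < j < i)%N)
    (e (X n i j) + 1) * f (shift (shift e (X n i.+1 j) (-1)) (X n i j) 1).
Proof.
move=> iltn; apply: eq_bigr => j ji; rewrite /xmul /dpart shiftE X_eq; try lia.
by rewrite [_ == _.+1]ltn_eqF //= addr0.
Qed.

(** Each summand of D multiplies by x_{i+1,r} / x_{i,r}, whose weight e_{i+1} - e_i does not depend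
    on r. *)
Lemma Dop_weighted lam mu i f : (i < n)%N -> weighted lam mu f ->
  weighted lam (fun j => mu j + root_at j i.+1 i) (Dop i f).
Proof.
move=> iltn /weightedP fw; apply/weightedP => j jn e; rewrite DopE // => D0.
have /existsP[r /andP[ri]] : [exists r : 'I_n.+1, (0 < r < i)%N &&
    (f (shift (shift e (X n i.+1 r) (-1)) (X n i r) 1) != 0)].
  apply: contra_neqT D0 => /existsPn H; apply: big1 => r ri.
  by have := H r; rewrite ri negbK /= => /eqP->; rewrite mulr0.
move=> /(fw j jn) <-; rewrite !wt_shift; try lia.
by rewrite /root_at; ring.
Qed.

Lemma iter_Dop_weighted lam mu i f p : (i < n)%N -> weighted lam mu f ->
  weighted lam (fun j => mu j + p%:R * root_at j i.+1 i) (iter p (Dop i) f).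
Proof.
move=> iltn fw; elim: p => [|p IH].
  by move=> j jn e; rewrite fw // mul0r addr0.
by move=> j jn e; rewrite (Dop_weighted iltn IH) // -natr1; congr (_ * _); ring.
Qed.

(** In the p-th term, D^p contributes p times e_{i+1} - e_i and the power of x_{i+1,i} contributes c
    - p times it; the total is the same for all p. *)
Lemma eta_weighted lam mu c i f g : (0 < i < n)%N -> weighted lam mu f ->
  eta_rel c i f g -> weighted lam (fun j => mu j + c * root_at j i.+1 i) g.
Proof.
move=> iin fw fg; apply/weightedP => j jn e; have [N /(_ N (leqnn N)) ->] := fg e => S0.
have /existsP[p] : [exists p : 'I_N,
    iter p (Dop i) f (shift e (X n i.+1 i) (- (c - p%:R))) != 0].
  apply: contra_neqT S0 => /existsPn H; apply: big1 => p _.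
  by have := H p; rewrite negbK => /eqP H0; rewrite /eta_term /xmul H0 mulr0.
have iltn : (i < n)%N by lia.
have /weightedP Dw := iter_Dop_weighted p iltn fw.
by move=> /(Dw j jn); rewrite wt_shift; try lia; move/(canRL (addrK _)) ->; ring.
Qed.

Lemma eq_weighted lam mu mu' f : (forall i, (0 < i < n)%N -> mu i = mu' i) ->
  weighted lam mu f -> weighted lam mu' f.
Proof. by move=> mm fw i ii e; rewrite fw // mm. Qed.

Lemma mon_weighted lam e0 : weighted lam (wt lam ^~ e0) (mon e0).
Proof.
apply/weightedP => i ii e; rewrite /mon.
by case: (e =P e0) => [->|_] //; rewrite eqxx.
Qed.

End Weights.

(** * Formal sums of monomials indexed by arrays *)

Section Gser.
Variables (C : fieldType) (n : nat).
Implicit Types (P : gam n -> Prop) (M : gam n -> expo C n) (c : gam n -> C).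

(* The series [\sum_(a | P a) c a x^(M a)], for [M] injective on [P]. *)
Definition gser P M c : series C n := fun e =>
  if pselect (exists a, P a /\ M a = e) is left h then c (projT1 (cid h)) else 0.

Definition inj_on P M := forall a b, P a -> P b -> M a = M b -> a = b.

Lemma gser_in P M c a : inj_on P M -> P a -> gser P M c (M a) = c a.
Proof.
move=> Minj Pa; rewrite /gser; case: pselect => [h|[]]; last by exists a.
by case: cid => b [Pb Mb] /=; congr c; apply: Minj.
Qed.

Lemma gser_out P M c e : (forall a, P a -> M a <> e) -> gser P M c e = 0.
Proof. by move=> H; rewrite /gser; case: pselect => // h; have [a [/H]] := h. Qed.

Lemma gser_neq0 P M c e : gser P M c e != 0 -> exists2 a, P a & M a = e.
Proof.
have [[a [Pa Ma]] _|N] := pselect (exists a, P a /\ M a = e); first by exists a.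
by rewrite gser_out ?eqxx // => a Pa Me; apply: N; exists a.
Qed.

Lemma eq_gser P P' M M' c c' : inj_on P M -> (forall a, P a <-> P' a) ->
  (forall a, P a -> M a = M' a) -> (forall a, P a -> c a = c' a) ->
  gser P M c =1 gser P' M' c'.
Proof.
move=> Minj PP MM cc e.
have [[a [Pa <-]]|N] := pselect (exists a, P a /\ M a = e).
  rewrite gser_in // MM // gser_in ?cc //; last exact/PP.
  by move=> a1 a2 /PP P1 /PP P2; rewrite -!MM //; apply: Minj.
rewrite !gser_out // => a.
  by move=> /PP Pa; rewrite -MM // => Me; apply: N; exists a.
by move=> Pa Me; apply: N; exists a.
Qed.

End Gser.

(** * Arrays in Gamma_{k,l}: the statistics r_i and t_i, and products of factorials *)

Section Gamma.
Variable n : nat.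
Implicit Types (a b : gam n) (p q : pos n).

Definition inc a q : gam n := [ffun p => (a p + (p == q))%N].

Lemma incE a q p : inc a q p = (a p + (p == q))%N.
Proof. exact: ffunE. Qed.

Lemma inc_pred a q : a q != 0%N -> exists b, a = inc b q.
Proof.
move=> aq; exists [ffun p => (a p - (p == q))%N]; apply/ffunP => p.
by rewrite !ffunE; case: eqP => [->|_]; rewrite ?subn0 ?addn0 //= subnK ?lt0n.
Qed.

Lemma sum_pos_eq q i : (\sum_(x < n.+1) \sum_(j < n.+1 | (j < i.+1 < x)%N) ((x, j) == q)
   = (q.2 < i.+1 < q.1)%N :> nat)%N.
Proof.
rewrite pair_big_dep /= (eq_bigr (fun p : pos n => (p == q) : nat)); last by case.
case: (boolP (q.2 < i.+1 < q.1)%N) => Hq.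
  rewrite (bigD1 q) //= eqxx big1 //; by move=> p /andP[_ /negPf->].
by rewrite big1 // => p; case: eqP => [->|//]; rewrite (negPf Hq).
Qed.

Lemma rr_inc a q i : rr (inc a q) i = (rr a i + (q.2 < i.+1 < q.1))%N.
Proof.
rewrite /rr -sum_pos_eq -big_split /=; apply: eq_bigr => x _.
by rewrite -big_split /=; apply: eq_bigr => j _; rewrite incE.
Qed.

Lemma tt_inc a q i : (i < n)%N -> tt (inc a q) i =
  (tt a i + (q.2 < i.+1 < q.1) + (q.1 == i.+1 :> nat) && (0 < q.2 < i))%N.
Proof.
move=> iltn; rewrite /tt rr_inc.
under eq_bigr do rewrite incE.
rewrite big_split /=.
suff -> : (\sum_(j < n.+1 | 0 < j < i) ((inord i.+1, j) == q)
     = (q.1 == i.+1 :> nat) && (0 < q.2 < i) :> nat)%N by lia.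
case: q => x y /=.
under eq_bigr do rewrite xpair_eqE.
rewrite -(inj_eq val_inj) /= inordK // eq_sym.
case: eqP => [xi|] /=; last by rewrite big1.
case: (boolP (0 < y < i)%N) => Hy.
  by rewrite (bigD1 y) //= eqxx big1 //; move=> j /andP[_ /negPf->].
by rewrite big1 // => j; case: eqP => [->|//]; rewrite (negPf Hy).
Qed.

Lemma le_rr a p i : (p.2 < i.+1 < p.1)%N -> (a p <= rr a i)%N.
Proof.
case: p => x y /= xy; rewrite /rr (bigD1 x) //= (bigD1 y) //=.
by rewrite -addnA leq_addr.
Qed.

Lemma rr_le_tt a i : (rr a i <= tt a i)%N. Proof. exact: leq_addr. Qed.

Definition facts a : nat := \prod_(p : pos n | lower p) (a p)`!.

Lemma facts_gt0 a : (0 < facts a)%N.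
Proof. by rewrite prodn_cond_gt0 // => p _; apply: fact_gt0. Qed.

Lemma facts_inc a q : lower q -> facts (inc a q) = ((a q).+1 * facts a)%N.
Proof.
move=> lq; rewrite /facts !(bigD1 q lq) /= incE eqxx addn1 factS -!mulnA.
by congr (_ * (_ * _))%N; apply: eq_bigr => p /andP[_ /negPf pq]; rewrite incE pq addn0.
Qed.

Lemma inGamma_row0 k l a p : inGamma k l a -> (l < p.1)%N -> a p = 0%N.
Proof. by move=> Ga lp; apply/eqP/negPn/negP => /eqP/Ga[_ _]; lia. Qed.

Lemma inGamma_adj0 k l a p : inGamma k l a -> p.1 = (p.2).+1 :> nat -> a p = 0%N.
Proof. by move=> Ga pp; apply/eqP/negPn/negP => /eqP/Ga[_ /eqP]. Qed.

Lemma inGamma_upper0 k l a p : inGamma k l a -> ~~ lower p -> a p = 0%N.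
Proof. by move=> Ga lp; apply/eqP/negPn/negP => /eqP/Ga[]; rewrite (negPf lp). Qed.

Lemma inGamma_inc k l a q : lower q -> q.1 != (q.2).+1 :> nat -> (q.1 <= l)%N ->
  (k <= q.2)%N -> inGamma k l (inc a q) <-> inGamma k l a.
Proof.
move=> lq aq ql kq; split=> Ga p.
  by move=> ap; apply: Ga; rewrite incE; lia.
by rewrite incE; case: (p =P q) => [->//|_]; rewrite addn0; apply: Ga.
Qed.

Lemma rr_last k l a : inGamma k l.+1 a -> rr a l = 0%N.
Proof.
move=> Ga; rewrite /rr big1 // => q _; rewrite big1 // => j jq.
by apply: inGamma_row0 Ga _ => /=; lia.
Qed.

(** Entries counted by r_{l-1} lie in rows q > l, and only row l+1 of [a] survives there. *)
Lemma rr_penult k l a : (l < n)%N -> inGamma k l.+1 a ->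
  rr a l.-1 = (\sum_(j < n.+1 | (0 < j < l)%N) a (inord l.+1, j))%N.
Proof.
move=> ln Ga; case: l => [|l] /= in ln Ga *.
  rewrite /rr !big1 // => [j|q _]; first by lia.
  rewrite big1 // => j jq; apply: inGamma_upper0 Ga _; rewrite /lower /=; lia.
rewrite /rr (bigD1 (inord l.+2)) //= [X in (_ + X)%N]big1 ?addn0; last first.
  move=> q ql; rewrite big1 // => j jq; apply: inGamma_row0 Ga _ => /=.
  by move: ql; rewrite -(inj_eq val_inj) /= inordK //; lia.
rewrite inordK // (bigID (fun j : 'I_n.+1 => (0 < j)%N)) /=.
rewrite [X in (_ + X)%N]big1 ?addn0; last first.
  by move=> j jq; apply: inGamma_upper0 Ga _; rewrite /lower /=; lia.
by apply: eq_bigl => j; lia.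
Qed.

Lemma tt_last k l a : (l < n)%N -> inGamma k l.+1 a -> tt a l = rr a l.-1.
Proof. by move=> ln Ga; rewrite (rr_penult ln Ga) /tt (rr_last Ga). Qed.

(** The entries of row l+1 are exactly those counted by r_{l-1}, so r_{l-1} = 0 says that this row
    vanishes. *)
Lemma inGammaS k l a : (l < n)%N -> inGamma k l.+1 a /\ rr a l.-1 = 0%N <-> inGamma k l a.
Proof.
move=> ln; split=> [[Ga r0] p ap|Ga].
  have [lp adj pl kp] := Ga p ap; split=> //.
  rewrite leqNgt; apply/negP => lp1; move: (lp); rewrite /lower => lp2.
  by have := @le_rr a p l.-1; lia.
have Ga1 : inGamma k l.+1 a by move=> p /Ga[? ? ? ?]; split=> //; lia.
split=> //; rewrite (rr_penult ln Ga1) big1 // => j jl.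
by apply: inGamma_row0 Ga _; rewrite /= inordK //; lia.
Qed.

End Gamma.

(** * Closed form for the iterates of D *)

Section Closed.
Variables (C : numFieldType) (n : nat).
Implicit Types (a b : gam n) (p q : pos n) (e : expo C n) (U : C) (w : nat -> C).

(** Condition on the starting monomial: for l > 0 it only involves variables x_{i+1,i} with i >=
    l. *)
Definition adj_above (l : nat) e :=
  forall p, (p.1 <= l)%N || (p.1 != (p.2).+1 :> nat) -> e p = 0.

(** The analogue of [mono] with the extra factor x^e0 and a free top parameter [U]. In the adjacent
    positions given by [U], [e0] is left out; it vanishes there whenever [adj_above l e0] holds. *)
Definition mono_from U k l e0 a : expo C n :=
  [ffun p : pos n => if ((p.1 : nat) == (p.2).+1) && (k <= p.2 < l)%N
             then U - (tt a p.2)%:R else (a p)%:R + e0 p].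

Lemma mono_from_nonadj U k l l' e0 a p : adj_above l' e0 ->
  p.1 != (p.2).+1 :> nat -> mono_from U k l e0 a p = (a p)%:R.
Proof. by move=> e0P ap; rewrite ffunE (negPf ap) /= e0P ?addr0 // ap orbT. Qed.

(** The exponents of the non-adjacent variables are the entries of [a], which characteristic 0 lets
    one read off. *)
Lemma mono_from_inj U k l l1 l2 e0 : adj_above l2 e0 ->
  inj_on (inGamma k l1) (mono_from U k l e0).
Proof.
move=> e0P a b Ga Gb /ffunP Mab; apply/ffunP => p.
have [pa|pa] := eqVneq (p.1 : nat) (p.2).+1.
  by rewrite (inGamma_adj0 Ga pa) (inGamma_adj0 Gb pa).
have := Mab p; rewrite !(mono_from_nonadj _ _ _ _ e0P pa).
by move/eqP; rewrite eqr_nat => /eqP.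
Qed.

(** [U] is independent of [w] because, after the inner reflection, the top value is already u_{m+1}
    while the u_i with i < m are unchanged. *)
Definition prefactor U w k m a : C :=
  \prod_(k <= i < m) (ff (w i) (rr a i) * ff (U - (rr a i)%:R) (tt a i - rr a i)).

Variables (k m : nat) (U : C) (w : nat -> C) (e0 : expo C n).
Hypotheses (k_gt0 : (0 < k)%N) (km : (k <= m)%N) (mn : (m.+2 <= n)%N).
Hypothesis e0P : adj_above m.+1 e0.

Let M := mono_from U k m.+1 e0.

(** The factor of index m is kept as one falling factorial of [U]: differentiating x_{m+1,m}^(U -
    t_m) lengthens it by exactly one factor. *)
Definition hcoef a : C := prefactor U w k m a * ff U (tt a m) / (facts a)%:R.

(* For [U = u_{m+1}] and [w = u], the [p]-th iterate of [Dop m.+1] on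
   [s_{e_k - e_(m+1)} (x^e0)], where [x^e0] already includes the factor
   [x_{m+2,m+1}^lambda_(m+1)] produced by [s_(m+1)]. *)
Definition hser (p : nat) : series C n :=
  gser (fun a => inGamma k m.+2 a /\ rr a m = p) M (fun a => (p`!)%:R * hcoef a).

Let M_inj (p : nat) : inj_on (fun a => inGamma k m.+2 a /\ rr a m = p) M.
Proof. by move=> a b [Ga _] [Gb _]; apply: (mono_from_inj e0P) Ga Gb. Qed.

(* The operator [x_{m+2,j} d_{m+1,j}] sends the exponent [source b j] to
   [inc b (X m.+2 j)]; for [j = m] the variable [x_{m+1,m}] carries no entry of
   [b], and its exponent [U - tt b m] drops instead. *)
Definition source b j := if (j < m)%N then inc b (X n m.+1 j) else b.

Lemma mono_from_move b j : (k <= j <= m)%N ->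
  shift (shift (M (inc b (X n m.+2 j))) (X n m.+2 j) (-1)) (X n m.+1 j) 1 = M (source b j).
Proof.
move=> kj; apply/ffunP => p; rewrite !shiftE !ffunE !eq_X; try lia.
case: p => x y /=.
case: ifP => [/andP[/eqP xy ky]|T].
  rewrite xy /source (fun_if (fun c => (tt c y))) !tt_inc; try lia.
  rewrite /= !inordK; try lia.
  have -> : (y.+1 == m.+2) && (y == j :> nat) = false by lia.
  set t := tt b y; set A := (t + _ + _)%N; set B := (if _ then _ else t).
  have -> : A = (B + (y.+1 == m.+1) && (y == j :> nat))%N.
    by rewrite /A /B; case: (ltnP j m) => jm; lia.
  case: ifP => _; rewrite ?addn0 ?addn1 -?natr1; ring.
rewrite /source; case: (ltnP j m) => jm; rewrite ?incE ?eq_X /=; try lia.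
  by do 2! case: (_ && _); rewrite /= ?addn0 ?addn1 -?natr1; ring.
have -> : (x == m.+1 :> nat) && (y == j :> nat) = false by lia.
by case: (_ && _); rewrite /= ?addn0 ?addn1 -?natr1; ring.
Qed.

Lemma rr_tgt b j i : (k <= j <= m)%N -> (i <= m)%N ->
  rr (inc b (X n m.+2 j)) i = (rr b i + (j <= i))%N.
Proof. by move=> *; rewrite rr_inc /= !inordK; lia. Qed.

Lemma rr_source b j i : (k <= j <= m)%N -> (i <= m)%N ->
  rr (source b j) i = (rr b i + (j <= i < m))%N.
Proof. by move=> *; rewrite /source; case: ifP => ?; rewrite ?rr_inc /= ?inordK; lia. Qed.

Lemma tt_tgt b j i : (k <= j <= m)%N -> (i <= m)%N ->
  tt (inc b (X n m.+2 j)) i = (tt b i + (j <= i))%N.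
Proof. by move=> *; rewrite tt_inc /= ?inordK; lia. Qed.

Lemma tt_source b j i : (k <= j <= m)%N -> (i <= m)%N ->
  tt (source b j) i = (tt b i + (j <= i) * (j < m))%N.
Proof. by move=> *; rewrite /source; case: ifP => ?; rewrite ?tt_inc /= ?inordK; lia. Qed.

(** Source and target have the same r_i and t_i for i < m, so their prefactors agree. If j < m, t_m
    agrees too and only the factorials of the two moved entries differ; if j = m, the derivative of
    x_{m+1,m} supplies the missing factor U - t_m of the falling factorial. *)
Lemma hcoef_move b j : (k <= j <= m)%N ->
  (inc b (X n m.+2 j) (X n m.+2 j))%:R * hcoef (inc b (X n m.+2 j)) =
  (M (inc b (X n m.+2 j)) (X n m.+1 j) + 1) * hcoef (source b j).
Proof.
move=> kj; set q := X n m.+2 j.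
have lq : lower q by rewrite /lower /= !inordK; lia.
have ls : lower (X n m.+1 j) = (j < m.+1)%N by rewrite /lower /= !inordK; lia.
have -> : hcoef (inc b q) = prefactor U w k m (source b j) * ff U (tt b m).+1
    / (facts (inc b q))%:R.
  rewrite /hcoef tt_tgt // (_ : (j <= m)%N) ?addn1; last by lia.
  congr (_ * _ / _); apply: eq_big_nat => i ki.
  by rewrite rr_tgt ?rr_source ?tt_tgt ?tt_source; try lia;
    congr (ff _ _ * ff (_ - _%:R) _); lia.
have f0 c : (facts c)%:R != 0 :> C by rewrite pnatr_eq0 -lt0n facts_gt0.
have s0 c : c.+1%:R != 0 :> C by rewrite pnatr_eq0.
rewrite facts_inc // incE eqxx addn1 natrM /hcoef tt_source //.
rewrite (_ : (j <= m)%N = true) ?mul1n; last by lia.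
case: (ltnP j m) => jm.
  rewrite (mono_from_nonadj _ _ _ _ e0P); last by rewrite /= !inordK; lia.
  rewrite /source jm facts_inc ?ls; last by lia.
  have -> : inc b q (X n m.+1 j) = b (X n m.+1 j).
    by rewrite incE X_eq; try lia; rewrite ltn_eqF //= addn0.
  rewrite addn1 natr1 natrM.
  by field; rewrite ![1 + _]addrC !natr1 !s0 f0.
have -> : j = m by lia.
rewrite /source ltnn addn0 [M]lock ffS -lock.
have -> : M (inc b q) (X n m.+1 m) = U - (tt b m).+1%:R.
  rewrite ffunE /= !inordK; try lia.
  rewrite eqxx ltnSn km /= tt_tgt; try lia.
  by rewrite (_ : (j <= m)%N) ?addn1 //; lia.
by rewrite -!natr1; field; rewrite natr1 s0 f0.
Qed.

Lemma inGamma_tgt b j : (k <= j <= m)%N ->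
  inGamma k m.+2 (inc b (X n m.+2 j)) <-> inGamma k m.+2 b.
Proof. by move=> kj; apply: inGamma_inc; rewrite /lower /= !inordK; lia. Qed.

Lemma inGamma_source b j : (k <= j <= m)%N ->
  inGamma k m.+2 (source b j) <-> inGamma k m.+2 b.
Proof.
move=> kj; rewrite /source; case: ifP => // jm.
by apply: inGamma_inc; rewrite /lower /= !inordK; lia.
Qed.

Lemma hser_Dop (p : nat) : Dop m.+1 (hser p) =1 hser p.+1.
Proof.
move=> e; rewrite DopE //.
pose mv j := shift (shift e (X n m.+2 j) (-1)) (X n m.+1 j) 1.
have mv1 (j : nat) : (0 < j < m.+1)%N -> e (X n m.+1 j) + 1 = mv j (X n m.+1 j).
  move=> jm; rewrite /mv !shiftE eqxx X_eq; try lia.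
  by rewrite [_ == _.+1]ltn_eqF //= addr0.
have mv2 (j : nat) : (0 < j < m.+1)%N -> mv j (X n m.+2 j) = e (X n m.+2 j) - 1.
  move=> jm; rewrite /mv !shiftE eqxx X_eq; try lia.
  by rewrite [_ == m.+1]gtn_eqF //= addr0.
have mvK j : e = shift (shift (mv j) (X n m.+1 j) (-1)) (X n m.+2 j) 1.
  by rewrite /mv shiftD addrN shift0 shiftD addNr shift0.
have nonadj (j : nat) : (0 < j < m.+1)%N -> ((X n m.+2 j).1 != (X n m.+2 j).2.+1 :> nat).
  by move=> jm; rewrite /= !inordK; lia.
have [[a [[Ga ra] Me]]|N] :=
    pselect (exists a, (inGamma k m.+2 a /\ rr a m = p.+1) /\ M a = e).
  rewrite -Me [hser p.+1 _]gser_in //.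
  transitivity (\sum_(j < n.+1 | (0 < j < m.+1)%N)
      (p`!)%:R * hcoef a * (a (X n m.+2 j))%:R); last first.
    rewrite -mulr_sumr -natr_sum.
    rewrite factS natrM -ra -[m in rr a m]/(m.+1.-1) (rr_penult _ Ga) //.
    rewrite [LHS]mulrC -[RHS]mulrA; congr (_%:R * _); apply: eq_bigr => j _.
    by rewrite /X inord_val.
  apply: eq_bigr => j jm; rewrite Me -/(mv j).
  (* If a_{m+2,j} = 0, a preimage would have exponent -1 at x_{m+2,j}, which is not a natural number
     in characteristic 0. Otherwise one unit can be removed there, and the preimage is
     [source b j]. *)
  have [a0|/[dup] a0 /inc_pred[b ab]] := eqVneq (a (X n m.+2 j)) 0%N.
    rewrite a0 mulr0 [hser _ _]gser_out ?mulr0 // => c _ Mc.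
    have := mv2 j jm; rewrite -Mc -Me !(mono_from_nonadj _ _ _ _ e0P (nonadj j jm)) a0.
    by move/eqP; rewrite sub0r -addr_eq0 natr1 pnatr_eq0.
  have kj : (k <= j <= m)%N.
    by move/eqP: a0 => /Ga[_ _ _]; rewrite /= inordK //; lia.
  have Gb : inGamma k m.+2 b by apply/(inGamma_tgt _ kj); rewrite -ab.
  have mvb : mv j = M (source b j) by rewrite -mono_from_move // -ab Me.
  rewrite mvb [hser p _]gser_in //.
    by rewrite mulrCA -Me ab -mulrA -hcoef_move // [hcoef _ * _]mulrC.
  split; first exact/inGamma_source.
  by move: ra; rewrite ab rr_tgt // rr_source //; lia.
rewrite [RHS]gser_out; last by move=> a Pa Me; apply: N; exists a.
(* A nonzero summand comes from some [c] in the support. If j < m, its nonzero derivative factor is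
   c_{m+1,j}, so [c] is a [source b j]; moving back then puts [e] into the support. *)
apply: big1 => j jm; apply/eqP; apply: contra_notT N; rewrite mulf_eq0 negb_or => /andP[e1].
rewrite -/(mv j) => /gser_neq0[c [Gc rc] Mc].
suff [b cb kj] : exists2 b, c = source b j & (k <= j <= m)%N.
  have Gb : inGamma k m.+2 b by apply/(inGamma_source _ kj); rewrite -cb.
  exists (inc b (X n m.+2 j)); split; first split.
  - exact/inGamma_tgt.
  - by move: rc; rewrite cb rr_tgt // rr_source //; lia.
  - by rewrite (mvK j) -Mc cb -mono_from_move // shiftD addrN shift0 shiftD addNr shift0.
rewrite /source; case: ltnP => jm'; last by exists c => //; lia.
move: e1; rewrite (mv1 j jm) -Mc (mono_from_nonadj _ _ _ _ e0P); last first.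
  by rewrite /= !inordK; lia.
rewrite pnatr_eq0 => /[dup] /eqP /Gc[_ _ _]; rewrite /= inordK // => kj /inc_pred[b ->].
by exists b => //; lia.
Qed.

Lemma iter_hser (f : series C n) : f =1 hser 0 ->
  forall p : nat, iter p (Dop m.+1) f =1 hser p.
Proof.
move=> f0; elim=> [|p IH] //= e; rewrite -hser_Dop !DopE //.
by apply: eq_bigr => j _; rewrite IH.
Qed.

End Closed.

(** * Simple reflections on the closed form, and the induction *)

Section Reflection.
Variables (C : numFieldType) (n : nat).
Implicit Types (a b : gam n) (e : expo C n) (lam mu : nat -> C).

Definition salpha_ser mu k l e0 : series C n :=
  gser (inGamma k l) (mono_from (u mu k l.-1) k l e0) (coeff mu k l).

Lemma coeffE mu k l a :
  coeff mu k l a = prefactor (u mu k l.-1) (u mu k) k l a / (facts a)%:R.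
Proof. by rewrite /coeff /facts natr_prod. Qed.

(** The monomial contains no x_{i,j} with j < i, so D kills it and only the term p = 0 of the series
    remains. *)
Lemma eta_mon c i e0 : (i < n)%N ->
  (forall j, (0 < j < i)%N -> e0 (X n i j) = 0) ->
  eta_rel c i (mon e0) (mon (shift e0 (X n i.+1 i) c)).
Proof.
move=> iltn e00.
have D0 p : iter p.+1 (Dop i) (mon e0) =1 fun=> 0.
  elim: p => [|p IH] e; rewrite iterS DopE //; apply: big1 => j ji.
    rewrite /= /mon; case: (shift _ _ _ =P e0) => [ee|_]; last by rewrite mulr0.
    have := e00 j ji; rewrite -ee !shiftE eqxx X_eq; try lia.
    by rewrite [_ == i.+1]ltn_eqF //= addr0 => ->; rewrite mul0r.
  by rewrite IH mulr0.
move=> e; exists 1%N => -[//|M] _.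
rewrite big_ord_recl big1 ?addr0 => [|p _]; last first.
  by rewrite /eta_term /xmul D0 mulr0.
rewrite /eta_term ff0 divr1 mul1r /xmul /mon subr0 /=.
have -> : (e == shift e0 (X n i.+1 i) c) = (shift e (X n i.+1 i) (- c) == e0) => //.
by apply/eqP/eqP => [->|<-]; rewrite shiftD ?addrN ?addNr shift0.
Qed.

(** Gamma_{k,k+1} contains only the zero array. *)
Lemma salpha_ser_simple mu k e0 : (0 < k < n)%N -> adj_above k.+1 e0 ->
  salpha_ser mu k k.+1 e0 =1 mon (shift e0 (X n k.+1 k) (lamr mu k)).
Proof.
move=> kn e0P e.
have Ga0 a : inGamma k k.+1 a -> a = [ffun=> 0%N].
  move=> Ga; apply/ffunP => p; rewrite ffunE; apply/eqP/negPn/negP => /eqP/Ga[].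
  by rewrite /lower; lia.
have G0 : inGamma k k.+1 ([ffun=> 0%N] : gam n) by move=> p; rewrite ffunE.
have r0 i : rr ([ffun=> 0%N] : gam n) i = 0%N.
  by rewrite /rr big1 // => q _; rewrite big1 // => j _; rewrite ffunE.
have t0 i : tt ([ffun=> 0%N] : gam n) i = 0%N.
  by rewrite /tt r0 big1 // => q _; rewrite ffunE.
have M0 : mono_from (u mu k k) k k.+1 e0 [ffun=> 0%N] = shift e0 (X n k.+1 k) (lamr mu k).
  apply/ffunP => -[x y]; rewrite !ffunE t0 eq_X /=; try lia.
  have -> : (x == y.+1 :> nat) && (k <= y < k.+1)%N =
     (x == k.+1 :> nat) && (y == k :> nat) by lia.
  case: ifP => xy; last by rewrite add0r addr0.
  by rewrite /u big_nat1 subr0 e0P ?add0r //=; lia.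
rewrite /mon; case: (e =P _) => [->|ne].
  rewrite -M0 /salpha_ser gser_in //; last exact: mono_from_inj e0P.
  rewrite coeffE /prefactor big_nat1 r0 t0 !ff0 !mul1r /facts big1 ?divr1 ?invr1 //.
  by move=> p _; rewrite ffunE.
rewrite /salpha_ser gser_out // => a /Ga0 ->; rewrite M0; exact: nesym.
Qed.

Lemma uS mu k i : (k <= i.+1)%N -> u mu k i.+1 = u mu k i + lamr mu i.+1.
Proof. by move=> ki; rewrite /u big_nat_recr. Qed.

(** * The outer reflection s_{m+1}, applied to the series for e_k - e_{m+1}, gives the one for e_k -
    e_{m+2} *)

Section Step.
Variables (mu mu1 : nat -> C) (k m : nat) (e0 : expo C n).
Hypotheses (k_gt0 : (0 < k)%N) (km : (k <= m)%N) (mn : (m.+2 <= n)%N).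
Hypothesis e0P : adj_above m.+2 e0.

Let U := u mu k m.+1.
Let e1 := shift e0 (X n m.+2 m.+1) (lamr mu m.+1).

Lemma adj_above_shift : adj_above m.+1 e1.
Proof.
move=> p Hp; rewrite shiftE eq_X; try lia.
rewrite e0P; last by lia.
by rewrite add0r; case: ifP => // /andP[]; lia.
Qed.

(** Since r_m = 0 on Gamma_{k,m+1}, the factor of index m reduces to the falling factorial of [U] of
    length t_m, as in [hcoef]. *)
Lemma salpha_ser_hser : (forall i, (k <= i < m)%N -> u mu1 k i = u mu k i) ->
  u mu1 k m = U -> salpha_ser mu1 k m.+1 e1 =1 hser k m U (u mu k) e1 0.
Proof.
move=> umu uU; rewrite /hser; apply: eq_gser.
- exact: mono_from_inj adj_above_shift.
- by move=> a; apply: iff_sym; apply: inGammaS; lia.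
- by move=> a _; rewrite uU.
move=> a Ga; rewrite mul1r coeffE /hcoef uU; congr (_ / _).
have /inGammaS[|_ r0] := Ga; first by lia.
rewrite /prefactor big_nat_recr //= r0 ff0 mul1r subr0 subn0; congr (_ * _).
by apply: eq_big_nat => i ki; rewrite umu.
Qed.

(** At x_{m+2,m+1} the exponents match because t_{m+1} = r_m and U = u_m + lambda_{m+1}. *)
Lemma mono_from_eta a : inGamma k m.+2 a ->
  mono_from U k m.+2 e0 a =
  shift (mono_from U k m.+1 e1 a) (X n m.+2 m.+1) (u mu k m - (rr a m)%:R).
Proof.
move=> Ga; apply/ffunP => -[x y]; rewrite shiftE !ffunE eq_X /=; try lia.
case: (boolP ((x == m.+2 :> nat) && (y == m.+1 :> nat))) => Hp.
  have [x1 y1] : x = m.+2 :> nat /\ y = m.+1 :> nat by lia.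
  rewrite x1 y1 eqxx ltnn ltnSn andbF /= andbT (_ : (k <= m.+1)%N); last by lia.
  have -> : e0 (x, y) = 0 by apply: e0P; rewrite /= x1 leqnn.
  rewrite (inGamma_adj0 Ga) /= ?x1 ?y1 // (tt_last _ Ga) //.
  by rewrite /U uS ?leqW //=; ring.
rewrite addr0 [e0 _ + 0]addr0.
by have -> : (x == y.+1 :> nat) && (k <= y < m.+2)%N =
   (x == y.+1 :> nat) && (k <= y < m.+1)%N by lia.
Qed.

(** The new factor of index m+1 is the falling factorial of [U] of length t_{m+1} = r_m. Multiplied
    by that of U - r_m of length t_m - r_m, it gives the one of length t_m in [hcoef]. *)
Lemma coeff_eta a : inGamma k m.+2 a ->
  coeff mu k m.+2 a = ff (u mu k m) (rr a m) * hcoef k m U (u mu k) a.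
Proof.
move=> Ga; rewrite coeffE /hcoef /prefactor !big_nat_recr //=; try lia.
rewrite (tt_last _ Ga) // (rr_last Ga) !ff0 subr0 subn0 -/U.
rewrite -(subnKC (rr_le_tt a m)) addKn !ffD /=; ring.
Qed.

Lemma eta_salpha_ser f : f =1 hser k m U (u mu k) e1 0 ->
  eta_rel (u mu k m) m.+1 f (salpha_ser mu k m.+2 e0).
Proof.
move=> f0 e; set c := u mu k m; pose G p := hser k m U (u mu k) e1 p.
have termE p : eta_term c m.+1 f p e =
    ff c p / (p`!)%:R * G p (shift e (X n m.+2 m.+1) (- (c - p%:R))).
  by rewrite /eta_term /xmul (iter_hser _ _ _ adj_above_shift f0).
have term0 p : (forall a, inGamma k m.+2 a -> rr a m = p -> mono_from U k m.+2 e0 a <> e) ->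
    eta_term c m.+1 f p e = 0.
  move=> H; rewrite termE [G _ _]gser_out ?mulr0 // => a [Ga ra] Me.
  by apply: (H a Ga ra); rewrite mono_from_eta // Me ra shiftD addNr shift0.
have Minj : inj_on (inGamma k m.+2) (mono_from U k m.+2 e0) by apply: mono_from_inj e0P.
have [[a [Ga Me]]|N] := pselect (exists a, inGamma k m.+2 a /\ mono_from U k m.+2 e0 a = e).
  (* Only the term p = r_m(a) reaches this exponent; its 1/p! cancels the p! in [hser]. *)
  exists (rr a m).+1 => M rM.
  rewrite (bigD1 (Ordinal rM)) //= big1 ?addr0 => [|p /eqP pr].
    rewrite termE -Me /salpha_ser gser_in // coeff_eta // mono_from_eta //.
    rewrite shiftD addrN shift0 /G [hser _ _ _ _ _ _ _]gser_in //; last first.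
      by move=> b b' [Gb _] [Gb' _]; apply: (mono_from_inj adj_above_shift) Gb Gb'.
    by rewrite [RHS]mulrA divfK // pnatr_eq0 -lt0n fact_gt0.
  apply: term0 => b Gb rb Mb; case: pr; apply: val_inj; rewrite /= -rb.
  by congr (rr _ m); apply: Minj; rewrite ?Me.
exists 0%N => M _; rewrite /salpha_ser gser_out; last first.
  by move=> a Ga Me; apply: N; exists a.
by rewrite big1 // => p _; apply: term0 => a Ga _ Me; apply: N; exists a.
Qed.

End Step.

Lemma root_at_adj i j : (i <= j)%N -> root_at C i j.+2 j.+1 = (i == j)%:R.
Proof.
move=> ij; rewrite /root_at /eps_at.
have [-> -> -> ->] : [/\ (j.+2 == i) = false, (j.+2 == i.+1) = false,
  (j.+1 == i) = false & (j.+1 == i.+1) = (i == j)] by split; lia.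
by rewrite /=; ring.
Qed.

(** The weight is carried along because the exponent of the outer reflection in the next step is
    read off from it. It is mu - (mu+rho)(alpha) alpha, with alpha = e_k - e_{k+d+1} identified with
    its coroot in the pairing. *)
Lemma salpha_mon lam k d e0 : (0 < k)%N -> (k + d < n)%N -> adj_above (k + d).+1 e0 ->
  let mu := wt lam ^~ e0 in
  salpha_rel lam k d (mon e0) (salpha_ser mu k (k + d).+1 e0) /\
  weighted lam (fun j => mu j + u mu k (k + d) * root_at C j (k + d).+1 k)
    (salpha_ser mu k (k + d).+1 e0).
Proof.
move=> k0; elim: d e0 => [|d IH] e0 dn e0P mu.
  rewrite addn0 in dn e0P *.
  have kn : (0 < k < n)%N by lia.
  have E : eta_rel (lamr mu k) k (mon e0) (salpha_ser mu k k.+1 e0).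
    move=> e; rewrite salpha_ser_simple //.
    by apply: eta_mon => // j jk; apply: e0P; rewrite /= !inordK; lia.
  split; first by exists mu; split => //; apply: mon_weighted.
  by rewrite /u big_nat1; apply: eta_weighted E => //; apply: mon_weighted.
rewrite addnS in dn e0P *; set m := (k + d)%N in IH dn e0P *.
have km : (k <= m)%N by apply: leq_addr.
pose c1 := lamr mu m.+1; pose e1 := shift e0 (X n m.+2 m.+1) c1.
have mu1E i : (0 < i < n)%N -> wt lam i e1 = mu i + c1 * root_at C i m.+2 m.+1.
  by move=> iin; rewrite wt_shift //; lia.
have e1P : adj_above m.+1 e1 by exact: (adj_above_shift mu k0 km dn e0P).
have [|S1 W1] := IH e1 _ e1P; first by lia.
set mu1 := wt lam ^~ e1 in S1 W1.
(* Among the indices up to m, the inner reflection changes only lambda_m, to which it adds c1 =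
   lambda_{m+1}. *)
have usum i : (k <= i <= m)%N -> u mu1 k i = u mu k i + c1 * (i == m)%:R.
  move=> ki; rewrite /u.
  transitivity (\sum_(k <= j < i.+1) (lamr mu j + c1 * (j == m)%:R)).
    apply: eq_big_nat => j kj; rewrite /lamr /mu1 mu1E; last by lia.
    by rewrite root_at_adj; [ring | lia].
  rewrite big_split /= -mulr_sumr; congr (_ + _ * _).
  have [->|im] := eqVneq i m.
    rewrite big_nat_recr //= eqxx big_nat big1 ?add0r // => j jm.
    by rewrite ltn_eqF //; lia.
  rewrite big_nat big1 // => j ji; rewrite ltn_eqF //; lia.
have uU : u mu1 k m = u mu k m.+1.
  by rewrite usum ?km ?leqnn // eqxx mulr1 uS // leqW.
have E : eta_rel (u mu k m) m.+1 (salpha_ser mu1 k m.+1 e1) (salpha_ser mu k m.+2 e0).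
  apply: eta_salpha_ser => //; apply: salpha_ser_hser => // i ki.
  by rewrite usum ?ltn_eqF ?mulr0 ?addr0 //; lia.
(* Exponent of the outer reflection: the inner one turns lambda_{m+1} into -c1, and s_{e_k -
   e_{m+1}} adds u_{m+1}, leaving u_{m+1} - c1 = u_m. *)
have c2 : mu1 m.+1 + u mu1 k m * root_at C m.+1 m.+1 k + 1 = u mu k m.
  rewrite uU uS ?leqW // /mu1 mu1E; last by lia.
  rewrite -[mu m.+1](addrK 1) -/(lamr mu m.+1) -/c1 /root_at /eps_at !eqxx.
  have [-> -> ->] : [/\ (m.+1 == m.+2) = false, (k == m.+1) = false &
    (k == m.+2) = false] by split; lia.
  by rewrite gtn_eqF //=; ring.
split.
  rewrite /= -/m addnS; exists (mon e1), (salpha_ser mu1 k m.+1 e1).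
  split; first exists mu; last split => //.
    split; first exact: mon_weighted.
    by apply: eta_mon => // j jm; apply: e0P; rewrite /= !inordK; lia.
  by exists (fun j => mu1 j + u mu1 k m * root_at C j m.+1 k); split => //; rewrite c2.
apply: eq_weighted (eta_weighted _ W1 E); last by lia.
(* The two outer shifts along e_{m+2} - e_{m+1} total c1 + u_m = u_{m+1}, so they combine with the
   middle one into u_{m+1} times e_{m+2} - e_k. *)
move=> i iin; rewrite uU /mu1 mu1E // uS ?leqW // -/c1 -(root_at_cat C i m.+2 m.+1 k) /=.
ring.
Qed.

End Reflection.

(** * The polynomiality criterion *)

Section Polynomial.
Variables (C : numFieldType) (n : nat).
Implicit Types (a : gam n) (lam : nat -> C).

Let zero_expo : expo C n := [ffun=> 0].

Lemma mono_from0 lam k l a : mono_from (u lam k l.-1) k l zero_expo a = mono lam k l a.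
Proof. by apply/ffunP => p; rewrite !ffunE addr0. Qed.

Lemma wt0 lam i : wt lam i zero_expo = lam i.
Proof.
rewrite /wt !big1 => [|j _|j _]; rewrite !ffunE ?subrr //.
by rewrite mulr0 !addr0 subr0.
Qed.

Lemma adj_above0 l : adj_above l zero_expo.
Proof. by move=> p _; rewrite ffunE. Qed.

(** An entry counted by r_i lies in row i+2, hence in the row sum of t_{i+1}, or in a lower row,
    hence in r_{i+1}. *)
Lemma rr_le_ttS k l a i : (i.+1 < n)%N -> inGamma k l a -> (rr a i <= tt a i.+1)%N.
Proof.
move=> iltn Ga; rewrite /tt /rr addnC (bigD1 (inord i.+2)) //= leq_add //.
  rewrite big_mkcond [leqRHS]big_mkcond leq_sum // => j _.
  case: ifP => // ji; case: ifP => // j0.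
  by rewrite (inGamma_upper0 Ga) // /lower /=; lia.
rewrite [leqLHS]big_mkcond leq_sum // => q _; case: ifP => // qi.
rewrite big_mkcond [leqRHS]big_mkcond leq_sum // => j _.
case: ifP => // jq; case: ifP => // /negP[]; move: qi jq.
by rewrite -(inj_eq val_inj) /= inordK //; lia.
Qed.

(** Descending induction from r_{l-1} = 0: once r_i <= m, the falling factorial of m - r_i of length
    t_i - r_i is nonzero only if t_i <= m, and then r_{i-1} <= t_i <= m. *)
Lemma coeff_neq0_tt_le lam k l a m : (l <= n)%N -> inGamma k l a ->
  u lam k l.-1 = m%:R -> coeff lam k l a != 0 ->
  forall i, (k <= i < l)%N -> (tt a i <= m)%N.
Proof.
move=> ln Ga um; rewrite coeffE mulf_eq0 negb_or => /andP[+ _].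
rewrite /prefactor prodf_seq_neq0 => /allP ff_neq0.
have tt_le i : (k <= i < l)%N -> (rr a i <= m)%N -> (tt a i <= m)%N.
  move=> ki rm; have := ff_neq0 i; rewrite mem_index_iota => /(_ ki) /=.
  rewrite mulf_eq0 negb_or um -natrB // => /andP[_]; rewrite leqNgt.
  by apply: contraNN => mt; rewrite ff_nat_eq0 // ltn_sub2r //; lia.
suff H d : forall i, (k <= i < l)%N -> (i + d).+1 = l -> (tt a i <= m)%N.
  by move=> i ki; apply: (H (l - i).-1) => //; lia.
elim: d => [|d IH] i ki il; apply: tt_le => //.
  have {}il : l = i.+1 by lia.
  by move: Ga; rewrite il => /rr_last ->.
by apply: leq_trans (rr_le_ttS _ Ga) (IH _ _ _); lia.
Qed.

Lemma is_poly_salpha_ser lam k l : (0 < k)%N -> (k < l)%N -> (l <= n)%N ->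
  is_poly (salpha_ser lam k l zero_expo) <-> exists m : nat, u lam k l.-1 = m%:R.
Proof.
move=> k0 kl ln; have Minj : inj_on (inGamma k l) (mono_from (u lam k l.-1) k l zero_expo).
  exact: mono_from_inj (@adj_above0 l).
split=> [[s Hs]|[m um]].
  have [G0 r0] : inGamma k l ([ffun=> 0%N] : gam n) /\
      forall i, rr ([ffun=> 0%N] : gam n) i = 0%N.
    split=> [p|i]; rewrite ?ffunE // /rr !big1 // => q _.
    by rewrite big1 // => j _; rewrite ffunE.
  have t0 i : tt ([ffun=> 0%N] : gam n) i = 0%N.
    by rewrite /tt r0 big1 // => q _; rewrite ffunE.
  (* The zero array has coefficient 1, and its exponent at x_{k+1,k} is u_{l-1}. *)
  have [|_] := Hs (mono_from (u lam k l.-1) k l zero_expo [ffun=> 0%N]).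
    rewrite /salpha_ser gser_in //.
    rewrite coeffE mulf_neq0 ?invr_eq0 ?pnatr_eq0 -?lt0n ?facts_gt0 //.
    by rewrite /prefactor big1 ?oner_neq0 // => i _; rewrite r0 t0 !ff0 mulr1.
  move/(_ (X n k.+1 k)) => [[m Hm] _]; exists m; rewrite -Hm ffunE /= !inordK; try lia.
  by rewrite eqxx leqnn kl /= t0 subr0.
(* Every entry of an array with nonzero coefficient is at most some t_i, hence at most m, so
   finitely many arrays suffice. *)
exists [seq mono lam k l [ffun p => f p : nat] | f : {ffun pos n -> 'I_m.+1}].
move=> e Ge; have [a Ga Me] := gser_neq0 Ge.
move: Ge; rewrite -Me /salpha_ser gser_in //.
move/(coeff_neq0_tt_le ln Ga um) => tm.
have am p : (a p <= m)%N.
  have [->//|/eqP/Ga[]] := eqVneq (a p) 0%N; case: p => x y.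
  rewrite /lower /= => lp xy xl ky.
  apply: leq_trans (@le_rr _ a (x, y) y _) _; first by rewrite /=; lia.
  by apply: leq_trans (rr_le_tt _ _) (tm _ _); lia.
rewrite mono_from0; split.
  apply/imageP; exists [ffun p => inord (a p)] => //.
  congr mono; apply/ffunP => p; rewrite !ffunE inordK // ltnS; exact: am.
move=> p; rewrite !ffunE.
case: ifP => [/andP[/eqP pp kp]|_].
  split; first by exists (m - tt a p.2)%N; rewrite um natrB // tm.
  by rewrite /lower pp; lia.
by split=> [|lp]; [exists (a p) | rewrite (inGamma_upper0 Ga lp)].
Qed.

End Polynomial.

Unset Implicit Arguments.

Theorem theorem4p2 (R : realType) (n : nat) (lam : nat -> R[i]) (k l : nat) :
  (2 <= n)%N -> (1 <= k)%N -> (k < l)%N -> (l <= n)%N ->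
  exists G : series R[i] n,
    salpha_rel lam k (l - k).-1 (@one_ser R[i] n) G /\
    (forall a : gam n, inGamma k l a -> G (mono lam k l a) = coeff lam k l a) /\
    (forall e : expo R[i] n,
        (forall a : gam n, inGamma k l a -> mono lam k l a <> e) -> G e = 0) /\
    (is_poly G <-> exists m : nat, u lam k l.-1 = m%:R).
Proof.
move=> _ k0 kl ln; exists (salpha_ser lam k l [ffun=> 0]).
(* The constant 1 is the monomial with zero exponent, whose weight is [lam] itself. *)
have wtE : wt lam ^~ ([ffun=> 0] : expo R[i] n) = lam by apply/funext => i; apply: wt0.
split.
  have kd : (k + (l - k).-1).+1 = l by lia.
  have dn : (k + (l - k).-1 < n)%N by lia.
  have [+ _] := salpha_mon lam k0 dn (@adj_above0 _ _ _).
  by rewrite wtE kd.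
split.
  move=> a Ga; rewrite -mono_from0 /salpha_ser gser_in //.
  exact: mono_from_inj (@adj_above0 _ _ l).
split; last exact: is_poly_salpha_ser.
move=> e He; rewrite /salpha_ser gser_out // => a Ga.
by rewrite mono_from0; apply: He.
Qed.
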